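(* Let $M$ be a (symmetric) positive semidefinite matrix, let $A_1, A_2, D$ be real matrices and $b$ a real vector of compatible dimensions, let $\mathcal{X}$ be a convex subset of the space of the variable $x_1$, and let $\|\cdot\|_p$ be any $p$-norm ($p\in[1,\infty]$). Consider the constrained problem $$\text{(C)}\qquad \min_{x_1\in\mathcal{X},\,x_2}\; x_1^{\mathsf T} M x_1\quad\text{subject to}\quad A_1x_1+A_2x_2=b,\quad \|Dx_2\|_p=0,$$ and, for $\lambda_w\ge 0$, the penalized problem $$\text{(P}_{\lambda_w})\qquad \min_{x_1\in\mathcal{X},\,x_2}\; x_1^{\mathsf T} M x_1+\lambda_w\|Dx_2\|_p\quad\text{subject to}\quad A_1x_1+A_2x_2=b.$$ Then: (i) for any fixed $\lambda_w\ge 0$, $(\mathrm{P}_{\lambda_w})$ is a convex relaxation of (C), i.e. the optimal value of $(\mathrm{P}_{\lambda_w})$ is no larger than that of (C); (ii) if there exists an optimal solution $(x_1^*,x_2^* )$ of (C) such that $x_1^*\in\mathcal{X}^\circ$, then there exists a finite $\lambda_w^*>0$ such that (C) and $(\mathrm{P}_{\lambda_w})$ are equivalent for all $\lambda_w>\lambda_w^*$, i.e. they have the same optimal solutions.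
   Context: $\mathcal{X}^\circ$ denotes the interior of $\mathcal{X}$. The variables $x_1,x_2$ are finite-dimensional real vectors; $x_2$ is unconstrained apart from the displayed constraints. *)

(* Defs.v *)
From mathcomp Require Export all_boot all_order all_algebra.
From mathcomp Require Export all_classical all_reals all_analysis.

Export Order.TTheory GRing.Theory Num.Theory.
Export numFieldNormedType.Exports.

#[export] Set Implicit Arguments.
#[export] Unset Strict Implicit.
#[export] Unset Printing Implicit Defensive.

Local Open Scope classical_set_scope.
Local Open Scope ring_scope.

Section PNorm.
Context {R : realType}.

(* The p-norm on R^n for p in [1, +oo]; the value at p = -oo is junk. *)
Definition pnorm (p : \bar R) n (x : 'cV[R]_n) : R :=
  match p with
  | r%:E => (\sum_(i < n) `|x i 0| `^ r) `^ r^-1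
  | +oo%E => \big[Num.max/0]_(i < n) `|x i 0|
  | -oo%E => 0
  end.

Definition quadform n (M : 'M[R]_n) (x : 'cV[R]_n) : R := (x^T *m M *m x) 0 0.

Definition psdmx n (M : 'M[R]_n) : Prop :=
  M \is symmetricmx /\ forall x : 'cV[R]_n, 0 <= quadform M x.

End PNorm.

Section Optimization.
Context {R : realType} {V : lmodType R}.

Record problem := Problem { objective : V -> R ; feasible : set V }.

(* An infimum, so that it is defined even when the minimum is not attained;
   it is +oo for an infeasible problem. *)
Definition optimal_value (P : problem) : \bar R :=
  ereal_inf [set (objective P x)%:E | x in feasible P].

Definition optimal_solutions (P : problem) : set V :=
  [set x | feasible P x /\
           forall y, feasible P y -> objective P x <= objective P y].

Definition convex_problem (P : problem) : Prop :=
  convex_set (feasible P) /\ convex_function (feasible P) (objective P).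

Definition convex_relaxation (P C : problem) : Prop :=
  convex_problem P /\ (optimal_value P <= optimal_value C)%E.

Definition equivalent_problems (C P : problem) : Prop :=
  optimal_solutions C = optimal_solutions P.

End Optimization.

Arguments problem {R} V.

Section Problems.
Context {R : realType} (n1 n2 m k : nat).
Variables (M : 'M[R]_n1) (A1 : 'M[R]_(m, n1)) (A2 : 'M[R]_(m, n2))
  (D : 'M[R]_(k, n2)) (b : 'cV[R]_m) (X : set 'cV[R]_n1) (p : \bar R).

Definition constrained_problem : problem ('cV[R]_n1 * 'cV[R]_n2)%type :=
  {| objective := fun x => quadform M x.1 ;
     feasible := [set x | [/\ X x.1, A1 *m x.1 + A2 *m x.2 = b
                            & pnorm p (D *m x.2) = 0]] |}.

Definition penalized_problem (lambda : R) :
    problem ('cV[R]_n1 * 'cV[R]_n2)%type :=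
  {| objective := fun x => quadform M x.1 + lambda * pnorm p (D *m x.2) ;
     feasible := [set x | X x.1 /\ A1 *m x.1 + A2 *m x.2 = b] |}.

End Problems.

(* Main.v *)
Require Import Defs.
From mathcomp Require Import ring lra.

(** A point feasible for (C) is feasible for (P) and its penalty vanishes
    there, so the value of (P) is at most that of (C).  The relaxation is
    convex because a psd quadratic form is convex ([quadform_conv]) and the
    p-norm satisfies the triangle inequality ([ler_pnormD]).

    For the exactness of the penalty, write f for the quadratic form and let
    x be an optimal solution of (C) with x.1 interior to X.  Near x the
    constraint x.1 in X is inactive and the remaining constraints of (C) are
    affine, so the gradient 2 M x.1 of f vanishes on the directions with
    A1 d1 + A2 d2 = 0 and D d2 = 0 ([constrained_stationary]).  Linear
    algebra then gives multipliers mu and nu with x.1^T M = mu A1 and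
    mu A2 = nu D ([lagrange_multipliers]).  Since f lies above its tangent at
    x.1, every y with A1 y.1 + A2 y.2 = b satisfies
      f y.1 >= f x.1 + 2 mu A1 (y.1 - x.1)
             = f x.1 - 2 mu A2 (y.2 - x.2) = f x.1 - 2 nu D y.2,
    and |nu z| is at most a constant times the p-norm of z.  Hence
    f x.1 <= f y.1 + c |D y.2|_p on the whole feasible set of (P)
    ([penalty_lower_bound]), which makes the penalty exact for every weight
    larger than c ([exact_penalty]). *)

Local Open Scope classical_set_scope.
Local Open Scope ring_scope.

(** * The p-norm on column vectors *)

Section PNormTheory.
Context {R : realType}.
Implicit Type p : \bar R.

Lemma pnorm_ge0 p n (x : 'cV[R]_n) : 0 <= pnorm p x.
Proof.
case: p => [r| |] //=; first exact: powR_ge0.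
by elim/big_ind: _ => // u v u0 v0; rewrite le_max u0.
Qed.

Lemma pnorm0 p n : (1 <= p)%E -> pnorm p (0 : 'cV[R]_n) = 0.
Proof.
case: p => [r| |] //=.
  rewrite lee_fin => r1; have r0 : r != 0 by rewrite gt_eqF// (lt_le_trans _ r1).
  rewrite big1 ?powR0 ?invr_eq0// => i _.
  by rewrite mxE normr0 powR0.
move=> _; elim/big_ind: _ => [//|u v -> ->|i _]; first by rewrite maxxx.
by rewrite mxE normr0.
Qed.

Lemma ler_coord_pnorm p n (x : 'cV[R]_n) i :
  (1 <= p)%E -> `|x i 0| <= pnorm p x.
Proof.
case: p => [r| |] //=; last first.
  by move=> _; exact: (le_bigmax_cond _ (fun i => `|x i 0|)).
rewrite lee_fin => r1; have r0 : 0 < r by rewrite (lt_le_trans _ r1).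
(* `|x i 0| is put in the form (`|x i 0| `^ r) `^ r^-1. *)
rewrite -[leLHS]powRr1// -(mulfV (lt0r_neq0 r0)) powRrM.
apply: ge0_ler_powR; rewrite ?invr_ge0 ?(ltW r0)// ?nnegrE ?powR_ge0//.
  by rewrite sumr_ge0// => j _; exact: powR_ge0.
by rewrite (bigD1 i)//= lerDl sumr_ge0// => j _; exact: powR_ge0.
Qed.

Lemma pnorm_eq0 p n (x : 'cV[R]_n) : (1 <= p)%E -> pnorm p x = 0 -> x = 0.
Proof.
move=> p1 x0; apply/matrixP => i j; rewrite ord1 mxE.
by apply/eqP; rewrite -normr_le0 -x0 ler_coord_pnorm.
Qed.

Lemma pnormZ p n (c : R) (x : 'cV[R]_n) : (1 <= p)%E -> 0 <= c ->
  pnorm p (c *: x) = c * pnorm p x.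
Proof.
case: p => [r| |] //=.
  rewrite lee_fin => r1 c0; have r0 : 0 < r by rewrite (lt_le_trans _ r1).
  transitivity ((c `^ r * \sum_(i < n) `|x i 0| `^ r) `^ r^-1).
    congr (_ `^ _); rewrite mulr_sumr; apply: eq_bigr => i _.
    by rewrite mxE normrM (ger0_norm c0) powRM.
  rewrite powRM ?powR_ge0//; last by rewrite sumr_ge0// => j _; exact: powR_ge0.
  by rewrite -powRrM mulfV ?gt_eqF// powRr1.
move=> _ c0; apply: (big_rec2 (fun u v => u = c * v)) => [|i u v _ ->].
  by rewrite mulr0.
by rewrite mxE normrM (ger0_norm c0) maxr_pMr.
Qed.

(** Convexity of the r-th power of the norm, inherited coordinatewise from
    that of the map u |-> u `^ r. *)
Lemma ler_sum_powR_conv n (r : R) (x y : 'cV[R]_n) (t : {i01 R}) : 1 <= r ->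
  \sum_(i < n) `|(t%:num *: x + (1 - t%:num) *: y) i 0| `^ r <=
  t%:num * (\sum_(i < n) `|x i 0| `^ r) +
  (1 - t%:num) * (\sum_(i < n) `|y i 0| `^ r).
Proof.
move=> r1; rewrite !mulr_sumr -big_split/=; apply: ler_sum => i _.
have r0 : 0 <= r by rewrite (le_trans _ r1).
have t1 : 0 <= 1 - (t%:num : R) by rewrite subr_ge0 le1.
apply: (le_trans (y := (t%:num * `|x i 0| + (1 - t%:num) * `|y i 0|) `^ r)).
  apply: ge0_ler_powR; rewrite ?nnegrE ?addr_ge0 ?mulr_ge0//.
  rewrite !mxE (le_trans (ler_normD _ _))// !normrM.
  by rewrite (ger0_norm t1) ger0_norm.
by apply: (convex_powR r1); rewrite inE/= in_itv/= andbT normr_ge0.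
Qed.

(** Stated on the sum of powers, without the outer root, to match the form of
    [ler_sum_powR_conv]. *)
Lemma sum_powR_normalized n (r : R) (x : 'cV[R]_n) :
  1 <= r -> 0 < pnorm r%:E x ->
  \sum_(i < n) `|((pnorm r%:E x)^-1 *: x) i 0| `^ r = 1.
Proof.
move=> r1 x0; have r0 : 0 < r by rewrite (lt_le_trans _ r1).
apply: (powR_injective (r := r^-1)).
- by rewrite invr_gt0.
- by rewrite nnegrE sumr_ge0// => i _; exact: powR_ge0.
- by rewrite nnegrE.
rewrite powR1 -[LHS]/(pnorm r%:E _) pnormZ ?invr_ge0 ?(ltW x0)//.
by rewrite mulVf// gt_eqF.
Qed.

(** For finite p, Minkowski's inequality amounts to the convexity of the unit
    ball: with a and b the norms of x and y, the vector (x + y) / (a + b) is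
    the convex combination of the unit vectors x / a and y / b with weight
    a / (a + b). *)
Lemma ler_pnormD p n (x y : 'cV[R]_n) : (1 <= p)%E ->
  pnorm p (x + y) <= pnorm p x + pnorm p y.
Proof.
move=> p1.
have [x0|xN0] := eqVneq (pnorm p x) 0.
  by rewrite x0 (pnorm_eq0 p1 x0) !add0r.
have [y0|yN0] := eqVneq (pnorm p y) 0.
  by rewrite y0 (pnorm_eq0 p1 y0) !addr0.
have {xN0}x_gt0 : 0 < pnorm p x by rewrite lt0r xN0 pnorm_ge0.
have {yN0}y_gt0 : 0 < pnorm p y by rewrite lt0r yN0 pnorm_ge0.
case: p p1 x_gt0 y_gt0 => [r| |] // p1 x_gt0 y_gt0; last first.
  apply: bigmax_le => [|i _]; first by rewrite addr_ge0 ?(ltW x_gt0) ?(ltW y_gt0).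
  rewrite mxE (le_trans (ler_normD _ _))// lerD//;
    exact: (@ler_coord_pnorm +oo%E).
have r1 : 1 <= r by rewrite -lee_fin.
have Sx := sum_powR_normalized r1 x_gt0.
have Sy := sum_powR_normalized r1 y_gt0.
move: (pnorm r%:E x) (pnorm r%:E y) x_gt0 y_gt0 Sx Sy => a b a0 b0 Sx Sy.
have ab0 : 0 < a + b by rewrite addr_gt0.
have [t tE] : exists t : {i01 R}, t%:num = a / (a + b).
  have t0 : 0 <= a / (a + b) by rewrite divr_ge0 ?(ltW a0) ?(ltW ab0).
  have t1 : a / (a + b) <= 1 by rewrite ler_pdivrMr// mul1r lerDl ltW.
  by exists (Itv01 t0 t1).
have := ler_sum_powR_conv (a^-1 *: x) (b^-1 *: y) t r1.
rewrite Sx Sy !mulr1 (addrC t%:num) subrK.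
set z := _ *: _ + _ *: _ => z1.
have -> : x + y = (a + b) *: z.
  rewrite /z tE scalerDr !scalerA; congr (_ + _); rewrite -[LHS]scale1r;
    congr (_ *: _); field; rewrite !gt_eqF//.
rewrite pnormZ ?(ltW ab0)// ler_piMr ?(ltW ab0)//=.
apply: (le_trans (y := 1 `^ r^-1)); last by rewrite powR1.
apply: ge0_ler_powR; rewrite ?nnegrE ?invr_ge0 ?(le_trans _ r1)//.
by rewrite sumr_ge0// => i _; exact: powR_ge0.
Qed.

(** A crude form of Hoelder's inequality: the 1-norm of u bounds its dual norm
    for every p at once, which is enough to get a finite penalty weight. *)
Lemma ler_mul_pnorm p n (u : 'rV[R]_n) (x : 'cV[R]_n) : (1 <= p)%E ->
  `|(u *m x) 0 0| <= (\sum_(i < n) `|u 0 i|) * pnorm p x.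
Proof.
move=> p1; rewrite mxE (le_trans (ler_norm_sum _ _ _))// mulr_suml.
by apply: ler_sum => i _; rewrite normrM ler_wpM2l// ler_coord_pnorm.
Qed.

End PNormTheory.

(** * Positive semidefinite quadratic forms *)

Section QuadraticForm.
Context {R : realType} {n : nat}.
Variable M : 'M[R]_n.
Hypothesis hM : psdmx M.
Implicit Types x y d : 'cV[R]_n.

Lemma quadformD_line x d (t : R) : quadform M (x + t *: d) =
  quadform M x + 2 * t * (x^T *m M *m d) 0 0 + t ^+ 2 * quadform M d.
Proof.
have MT : M^T = M.
  have [+ _] := hM; rewrite is_hermitianmxE => /eqP MS.
  by rewrite {2}MS expr0 scale1r map_mx_id.
have dMx : (d^T *m M *m x) 0 0 = (x^T *m M *m d) 0 0.
  by rewrite -[d^T *m M *m x]trmxK mxE !trmx_mul trmxK MT mulmxA.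
rewrite /quadform [(x + _)^T]linearD/= [(t *: d)^T]linearZ/=
  !mulmxDl !mulmxDr -!scalemxAl -!scalemxAr.
move: dMx.
move: (d^T *m M *m x) (x^T *m M *m d) (x^T *m M *m x) (d^T *m M *m d).
by move=> B C E G dMx; rewrite !mxE dMx; ring.
Qed.

Lemma quadform_tangent x y :
  quadform M x + 2 * (x^T *m M *m (y - x)) 0 0 <= quadform M y.
Proof.
have := quadformD_line x (y - x) 1.
rewrite scale1r (addrC x) subrK => ->.
by rewrite mulr1 expr1n mul1r lerDl hM.2.
Qed.

Lemma quadform_conv x y (t : R) : 0 <= t <= 1 ->
  quadform M (t *: x + (1 - t) *: y) <=
  t * quadform M x + (1 - t) * quadform M y.
Proof.
move=> /andP[t0 t1].
have -> : t *: x + (1 - t) *: y = y + t *: (x - y).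
  by rewrite scalerBl scale1r scalerBr addrCA addrA.
have -> : quadform M x = quadform M (y + 1 *: (x - y)).
  by rewrite scale1r addrC subrK.
rewrite !quadformD_line.
have := mulr_ge0 (mulr_ge0 t0 (_ : 0 <= 1 - t)) (hM.2 (x - y)).
by rewrite subr_ge0 => /(_ t1); nra.
Qed.

(** With a half the directional derivative along d and q the value of the form
    at d, moving by t = - s a changes the form by - s a^2 (2 - s q), which is
    negative for small s > 0 unless a = 0. *)
Lemma quadform_stationary x d :
  (\forall t \near (0 : R), quadform M x <= quadform M (x + t *: d)) ->
  (x^T *m M *m d) 0 0 = 0.
Proof.
set a := (x^T *m M *m d) 0 0; set q := quadform M d => xmin.
apply/eqP; apply/negPn/negP => aN0.
have a2 : 0 < a ^+ 2 by rewrite exprn_even_gt0.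
have cvs : (fun s : R => - s * a) @ 0 --> (0 : R).
  rewrite -[X in _ --> X](mul0r a) -[X in X * a]oppr0.
  by apply: cvgMl; apply: cvgN; exact: cvg_id.
have q1 : 0 < q + 1 by rewrite ltr_wpDl// hM.2.
have [s [s0 sq xs]] : exists s : R, [/\ 0 < s, s * q < 2 &
    quadform M x <= quadform M (x + (- s * a) *: d)].
  (* q may vanish, so s is bounded through q + 1, which is positive. *)
  near (0 : R)^'+ => s; exists s; split; first by [].
    rewrite (@le_lt_trans _ _ (s * (q + 1)))//; first by rewrite ler_wpM2l// lerDl.
    rewrite -ltr_pdivlMr//.
    by near: s; apply: nbhs_right_lt; exact: divr_gt0.
  by near: s; apply: cvg_within; exact: cvs xmin.
move: xs; rewrite quadformD_line -/a -/q -addrA lerDl.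
have : 0 < (s * a ^+ 2) * (2 - s * q).
  by apply: mulr_gt0; [exact: mulr_gt0|rewrite subr_gt0].
by nra.
Unshelve. all: by end_near. Qed.

End QuadraticForm.

(** * Multipliers and exact penalties *)

Lemma near_line (R : realType) n (X : set 'cV[R]_n) (x d : 'cV[R]_n) :
  X° x -> \forall t \near (0 : R), X (x + t *: d).
Proof.
move=> Xx.
have cvl : (fun t : R => x + t *: d) @ 0 --> x.
  rewrite -[X in _ --> X]addr0 -(scale0r d).
  by apply: cvgD; [exact: cvg_cst|apply: cvgZl; exact: cvg_id].
exact: cvl Xx.
Qed.

(** Duality between kernel and row space: the columns of the cokernel matrix
    of B span the kernel of B, and g belongs to the row space of B as soon as
    it kills them. *)
Lemma submx_ker (F : fieldType) m n l (B : 'M[F]_(m, n)) (g : 'M[F]_(l, n)) :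
  (forall d : 'cV_n, B *m d = 0 -> g *m d = 0) -> (g <= B)%MS.
Proof.
move=> ker; rewrite submxE; apply/eqP/matrixP => i j.
have : g *m (cokermx B *m delta_mx j (0 : 'I_1)) = 0.
  by apply: ker; rewrite mulmxA mulmx_coker mul0mx.
by rewrite mulmxA -colE => /matrixP/(_ i 0); rewrite mxE => ->; rewrite !mxE.
Qed.

(** The bound says that x0 minimizes f + c g over F.  Raising the weight to
    lambda > c leaves the value at x0 unchanged and increases the value
    strictly wherever g > 0, so every minimizer of f + lambda g has g = 0. *)
Lemma exact_penalty (R : realType) (V : lmodType R) (f g : V -> R) (F : set V)
    (c lambda : R) (x0 : V) :
  (forall y, F y -> 0 <= g y) -> F x0 -> g x0 = 0 ->
  (forall y, F y -> f x0 <= f y + c * g y) -> c < lambda ->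
  equivalent_problems (Problem f (F `&` [set x | g x = 0]))
    (Problem (fun x => f x + lambda * g x) F).
Proof.
move=> g0 Fx0 gx0 fx0 clam; apply/seteqP; split=> x /=.
  move=> [[Fx gx]] xmin; split=> // y Fy /=.
  rewrite gx mulr0 addr0 (le_trans (xmin x0 (conj Fx0 gx0)))//.
  by rewrite (le_trans (fx0 y Fy))// lerD2l ler_wpM2r ?g0 ?ltW.
move=> [Fx xmin].
have gx : g x = 0.
  have := xmin _ Fx0; rewrite /= gx0 mulr0 addr0 => xx0.
  have := le_trans xx0 (fx0 _ Fx); rewrite lerD2l -subr_ge0 -mulrBl.
  rewrite nmulr_rge0 ?subr_lt0// => gx.
  by apply/eqP; rewrite eq_le gx g0.
split=> // y [Fy gy]; have := xmin _ Fy.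
by rewrite /= gx gy mulr0 !addr0.
Qed.

(** * The constrained and the penalized problem *)

Section ConstrainedAndPenalized.
Context {R : realType} {n1 n2 m k : nat}.
Variables (M : 'M[R]_n1) (A1 : 'M[R]_(m, n1)) (A2 : 'M[R]_(m, n2))
  (D : 'M[R]_(k, n2)) (b : 'cV[R]_m) (X : set 'cV[R]_n1) (p : \bar R).
Hypotheses (hM : psdmx M) (hp : (1 <= p)%E).

Lemma constrained_stationary (x : 'cV[R]_n1 * 'cV[R]_n2) :
  optimal_solutions (constrained_problem M A1 A2 D b X p) x -> X° x.1 ->
  forall (d1 : 'cV[R]_n1) (d2 : 'cV[R]_n2),
    A1 *m d1 + A2 *m d2 = 0 -> D *m d2 = 0 ->
    (x.1^T *m M *m d1) 0 0 = 0.
Proof.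
move=> [[/= _ xb /(pnorm_eq0 hp) xD] xmin] Xx d1 d2 Ad Dd.
apply: quadform_stationary => //.
apply: filterS (near_line d1 Xx) => t Xt.
apply: (xmin (x.1 + t *: d1, x.2 + t *: d2)); split=> //=.
  by rewrite !mulmxDr -!scalemxAr addrACA xb -scalerDr Ad scaler0 addr0.
by rewrite mulmxDr -scalemxAr xD Dd scaler0 addr0 pnorm0.
Qed.

(** The hypothesis says that (g, 0) vanishes on the kernel of the matrix of all
    the equality constraints, hence lies in its row space. *)
Lemma lagrange_multipliers (g : 'rV[R]_n1) :
  (forall (d1 : 'cV[R]_n1) (d2 : 'cV[R]_n2),
    A1 *m d1 + A2 *m d2 = 0 -> D *m d2 = 0 ->
    (g *m d1) 0 0 = 0) ->
  exists mu : 'rV[R]_m, exists nu : 'rV[R]_k,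
    g = mu *m A1 /\ mu *m A2 = nu *m D.
Proof.
move=> ker.
have /submxP[w] : (row_mx g 0 <= block_mx A1 A2 0 D)%MS.
  apply: submx_ker => d; rewrite -(vsubmxK d) mul_block_col mul_row_col.
  rewrite !mul0mx add0r addr0 -col_mx0 => /eq_col_mx[Ad Dd].
  by apply/matrixP => i j; rewrite !ord1 [RHS]mxE; exact: ker Ad Dd.
rewrite -(hsubmxK w) mul_row_block mulmx0 addr0 => /eq_row_mx[gE zE].
exists (lsubmx w), (- rsubmx w); split=> //.
by apply/eqP; rewrite mulNmx -addr_eq0 -zE.
Qed.

(** The multiplier nu prices the violation of D y.2 = 0, and the factor 2 comes
    from the gradient of the quadratic form. *)
Lemma penalty_lower_bound (x : 'cV[R]_n1 * 'cV[R]_n2) :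
  optimal_solutions (constrained_problem M A1 A2 D b X p) x -> X° x.1 ->
  exists2 c : R, 0 <= c & forall y : 'cV[R]_n1 * 'cV[R]_n2,
    A1 *m y.1 + A2 *m y.2 = b ->
    quadform M x.1 <= quadform M y.1 + c * pnorm p (D *m y.2).
Proof.
move=> xopt Xx.
have [mu [nu [gE muA2]]] :=
  lagrange_multipliers (constrained_stationary xopt Xx).
move: xopt => [[/= _ xb /(pnorm_eq0 hp) xD] _].
exists (2 * \sum_(i < k) `|nu 0 i|); first by rewrite mulr_ge0// sumr_ge0.
move=> y yb; have := quadform_tangent hM x.1 y.1.
have -> : (x.1^T *m M *m (y.1 - x.1)) 0 0 = - (nu *m (D *m y.2)) 0 0.
  suff -> : x.1^T *m M *m (y.1 - x.1) = - (nu *m (D *m y.2)) by rewrite mxE.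
  rewrite gE -mulmxA mulmxBr.
  have -> : A1 *m y.1 - A1 *m x.1 = - (A2 *m (y.2 - x.2)).
    apply/eqP; rewrite mulmxBr opprB subr_eq addrAC -subr_eq opprK yb.
    by rewrite addrC xb.
  by rewrite mulmxN (mulmxA mu) muA2 -mulmxA mulmxBr xD subr0.
have := le_trans (ler_norm _) (ler_mul_pnorm nu (D *m y.2) hp).
by nra.
Qed.

Lemma convex_penalized_problem lambda : convex_set X -> 0 <= lambda ->
  convex_problem (penalized_problem M A1 A2 D b X p lambda).
Proof.
move=> hX lam0; split=> [x y t|t x y _ _].
  rewrite !inE/= => -[Xx xb] [Xy yb]; split.
    by have := hX x.1 y.1 t; rewrite !inE; apply.
  rewrite !mulmxDr -!scalemxAr addrACA -!scalerDr xb yb -scalerDl.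
  by rewrite addrC subrK scale1r.
have t01 : 0 <= (t%:num : R) <= 1 by rewrite ge0 le1.
have t1 : 0 <= 1 - (t%:num : R) by rewrite subr_ge0 le1.
rewrite convRE /= !mulmxDr -!scalemxAr.
have := quadform_conv hM x.1 y.1 t01.
have := ler_pnormD (t%:num *: (D *m x.2)) ((1 - t%:num) *: (D *m y.2)) hp.
rewrite !pnormZ// => /(ler_wpM2l lam0).
by rewrite /unstable.onem; lra.
Qed.

Lemma penalized_optimal_value_le lambda :
  (optimal_value (penalized_problem M A1 A2 D b X p lambda) <=
   optimal_value (constrained_problem M A1 A2 D b X p))%E.
Proof.
apply: ereal_inf_le_tmp => _ [x [/= Xx xb xD] <-]; exists x; first by [].
by rewrite /= xD mulr0 addr0.
Qed.

Lemma equivalent_of_penalty_bound (x : 'cV[R]_n1 * 'cV[R]_n2) (c lambda : R) :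
  feasible (constrained_problem M A1 A2 D b X p) x ->
  (forall y : 'cV[R]_n1 * 'cV[R]_n2, A1 *m y.1 + A2 *m y.2 = b ->
    quadform M x.1 <= quadform M y.1 + c * pnorm p (D *m y.2)) ->
  c < lambda ->
  equivalent_problems (constrained_problem M A1 A2 D b X p)
    (penalized_problem M A1 A2 D b X p lambda).
Proof.
move=> [/= Xx xb xD] bnd clam; rewrite /constrained_problem.
have -> : [set x : 'cV[R]_n1 * 'cV[R]_n2 | [/\ X x.1, A1 *m x.1 + A2 *m x.2 = b
      & pnorm p (D *m x.2) = 0]] =
    [set x | X x.1 /\ A1 *m x.1 + A2 *m x.2 = b] `&`
    [set x | pnorm p (D *m x.2) = 0].
  by apply/seteqP; split=> [y []|y [[]]].
apply: (exact_penalty (c := c) (x0 := x)) => // y.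
  by move=> _; exact: pnorm_ge0.
by case=> _; exact: bnd.
Qed.

End ConstrainedAndPenalized.

Theorem theorem1 (R : realType) (n1 n2 m k : nat) (M : 'M[R]_n1)
    (A1 : 'M[R]_(m, n1)) (A2 : 'M[R]_(m, n2)) (D : 'M[R]_(k, n2))
    (b : 'cV[R]_m) (X : set 'cV[R]_n1) (p : \bar R)
    (hM : psdmx M) (hX : convex_set X) (hp : (1 <= p)%E) :
  (forall lambda : R, 0 <= lambda ->
     convex_relaxation (penalized_problem M A1 A2 D b X p lambda)
       (constrained_problem M A1 A2 D b X p)) /\
  ((exists x : 'cV[R]_n1 * 'cV[R]_n2,
      optimal_solutions (constrained_problem M A1 A2 D b X p) x /\ X° x.1) ->
   exists lambda_star : R, 0 < lambda_star /\
     forall lambda : R, lambda_star < lambda ->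
       equivalent_problems (constrained_problem M A1 A2 D b X p)
         (penalized_problem M A1 A2 D b X p lambda)).
Proof.
split=> [lambda lam0|[x [xopt Xx]]].
  split; first exact: convex_penalized_problem.
  exact: penalized_optimal_value_le.
have [c c0 bnd] := penalty_lower_bound hM hp xopt Xx.
(* c may be 0, whereas the threshold must be positive. *)
exists (c + 1); split=> [|lambda clam]; first by rewrite ltr_wpDl.
apply: equivalent_of_penalty_bound xopt.1 bnd _ => //.
by rewrite (le_lt_trans _ clam)// lerDl.
Qed.
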